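(* Let $\Omega$ be a nonempty finite set, let $Z$ be a separable metric space, and let $\mathcal{R}$ be a binary relation on the set of Anscombe--Aumann acts $\mathscr{F}(\Omega,Z)$. Then $\mathcal{R}$ is reflexive and satisfies the independence axiom if and only if there exists a nonempty family $\mathscr{K}\subseteq\mathcal{P}(\mathrm{C}_b(Z\times\Omega))$ of nonempty subsets such that, for all $f,g\in\mathscr{F}(\Omega,Z)$, one has $(f,g)\in\mathcal{R}$ if and only if $$\forall K\in\mathscr{K},\ \exists u\in K,\quad \sum_{\omega\in\Omega}\mathbf{E}_{f(\omega)}[u(\cdot,\omega)]\ \ge\ \sum_{\omega\in\Omega}\mathbf{E}_{g(\omega)}[u(\cdot,\omega)].$$
   Context: $\Delta(Z)$ is the set of Borel probability measures on $Z$, and $\mathscr{F}(\Omega,Z):=\Delta(Z)^\Omega$ is the set of functions $f:\Omega\to\Delta(Z)$ (Anscombe--Aumann acts), viewed as a convex subset of the vector space $\mathrm{ca}(Z)^\Omega$, where $\mathrm{ca}(Z)$ is the space of countably additive finite signed Borel measures on $Z$. $\mathrm{C}_b(Z\times\Omega)$ is the space of bounded continuous real functions on $Z\times\Omega$ (with $\Omega$ discrete), $\mathcal{P}(\cdot)$ denotes the power set, and $\mathbf{E}_r[v]:=\int v\,\mathrm{d}r$ for $r\in\Delta(Z)$ and $v\in\mathrm{C}_b(Z)$. A binary relation on a set $S$ is a subset $\mathcal{R}\subseteq S^2$. If $S$ is a convex subset of a vector space, $\mathcal{R}$ satisfies the independence axiom if for all $a,b,c\in S$ and all $\alpha\in(0,1)$,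 $$(a,b)\in\mathcal{R}\iff(\alpha a+(1-\alpha)c,\ \alpha b+(1-\alpha)c)\in\mathcal{R}.$$ *)

(* Defs.v *)
From HB Require Import structures.
From mathcomp Require Import all_boot all_order all_algebra.
From mathcomp Require Import all_classical all_reals all_analysis.

Set Implicit Arguments.
Unset Strict Implicit.
Unset Printing Implicit Defensive.

Import Order.TTheory GRing.Theory Num.Theory.
Import numFieldNormedType.Exports.

Local Open Scope classical_set_scope.
Local Open Scope ring_scope.

Definition binary_relation {V : Type} (S : set V) (Rel : set (V * V)) :=
  Rel `<=` S `*` S.

Definition reflexive_on {V : Type} (S : set V) (Rel : set (V * V)) :=
  forall a, S a -> Rel (a, a).

Definition independence_axiom {R : realType} {V : lmodType R} (S : set V)
    (Rel : set (V * V)) :=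
  forall a b c, S a -> S b -> S c -> forall alpha : R, 0 < alpha < 1 ->
    Rel (a, b) <->
    Rel (alpha *: a + (1 - alpha) *: c, alpha *: b + (1 - alpha) *: c).

Definition separable (T : topologicalType) :=
  exists D : set T, countable D /\ dense D.

Definition borel (T : topologicalType) : set (set T) := <<s open >>.

Section ca.
Context {R : realType} {Z : topologicalType}.

Definition countably_additive (mu : set Z -> R^o) :=
  forall A : (set Z)^nat, (forall n, borel (A n)) -> trivIset setT A ->
    (fun n => \sum_(i < n) mu (A i)) @ \oo --> mu (\bigcup_n A n).

(* A signed measure is represented by its extension by 0 to all subsets, so
   that measures which agree on the Borel sets are equal. Countable additivity
   with real values forces mu set0 = 0. *)
Definition ca_pred : {pred set Z -> R^o} := fun mu =>
  `[< countably_additive mu /\ forall A, ~ borel A -> mu A = 0 >].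

Lemma ca_submod : submod_closed ca_pred.
Proof.
split.
  apply/asboolP; split=> [A _ _|//]; rewrite [X in _ --> X](_ : _ = 0)//.
  by under eq_fun do rewrite big1//; exact: cvg_cst.
move=> a mu nu /asboolP[mus mu0] /asboolP[nus nu0]; apply/asboolP; split.
  move=> A bA tA; rewrite [X in X @ _ --> _](_ : _ = (fun n =>
      a *: (\sum_(i < n) mu (A i)) + \sum_(i < n) nu (A i))); last first.
    by apply/funext => n; rewrite scaler_sumr -big_split.
  by apply: cvgD; [apply: cvgZl_tmp; exact: mus|exact: nus].
by move=> A bA; rewrite !fctE mu0// nu0// scaler0 addr0.
Qed.

HB.instance Definition _ := GRing.isSubmodClosed.Build _ _ ca_pred ca_submod.

End ca.

Record ca (R : realType) (Z : topologicalType) :=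
  Ca { ca_fun :> set Z -> R^o ; _ : ca_fun \in ca_pred }.
HB.instance Definition _ R Z := [isSub for @ca_fun R Z].
HB.instance Definition _ R Z := [Choice of ca R Z by <:].
HB.instance Definition _ R Z := [SubChoice_isSubLmodule of ca R Z by <:].

Definition Delta (R : realType) (Z : topologicalType) : set (ca R Z) :=
  [set r | (forall A, borel A -> 0 <= r A) /\ r setT = 1].

Definition acts (R : realType) (Omega : finType) (Z : topologicalType)
    : set (Omega -> ca R Z) :=
  [set f | forall w, @Delta R Z (f w)].

Definition Cb (R : realType) (T : topologicalType) : set (T -> R) :=
  [set u | continuous u /\ bounded_fun u].

Arguments Delta R Z : clear implicits.
Arguments acts R Omega Z : clear implicits.
Arguments Cb R T : clear implicits.

(* Measurable types of the library are pointed: [borel_at z] is [Z] with its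
   Borel sigma-algebra and the distinguished point [z]. *)
Definition pointed_at (T : Type) (z : T) : Type := T.
HB.instance Definition _ (T : choiceType) (z : T) :=
  Choice.copy (pointed_at z) T.
HB.instance Definition _ (T : choiceType) (z : T) :=
  isPointed.Build (pointed_at z) z.

Definition borel_at (Z : topologicalType) (z : Z) :=
  g_sigma_algebraType (@open Z : set (set (pointed_at z))).

(* Meant for [r] in [Delta R Z]. The integral does not depend on the chosen
   point; if [Z] is empty, so is [Delta R Z], and the value is irrelevant. *)
Definition expect {R : realType} {Z : topologicalType} (r : ca R Z) (v : Z -> R) : R :=
  if pselect ([set: Z] !=set0) is left Z0 then
    fine (\int[(fun A => (r A)%:E) : set (borel_at (projT1 (cid Z0))) -> \bar R]_x
      (v x)%:E)%E
  else 0.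

(* Main.v *)
Require Import Defs.
From HB Require Import structures.
From mathcomp Require Import all_boot all_order all_algebra.
From mathcomp Require Import all_classical all_reals all_analysis.
From mathcomp Require Import measurable_realfun.
From mathcomp Require Import ring lra.

Set Implicit Arguments.
Unset Strict Implicit.
Unset Printing Implicit Defensive.

Import Order.TTheory GRing.Theory Num.Theory.
Import numFieldNormedType.Exports.

Local Open Scope classical_set_scope.
Local Open Scope ring_scope.

(** Write [<u, f>] for the sum over the states [w] of the expectation of
    [u (., w)] under [f w]. This pairing is affine in the act [f], linear in the
    bounded continuous utility [u], and it separates acts. These properties
    alone imply the theorem, which is proved as [independence_representation]
    for any convex set paired in this way with a vector space.

    A relation represented by a family of sets of utilities satisfies
    independence because mixing two acts with a third one multiplies each
    difference [<u, f> - <u, g>] by a positive number.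

    Conversely, under independence, whether [f] is related to [g] depends only
    on the direction of [f - g] ([independence_cross]). To exclude an unrelated
    pair [(f0, g0)], use the set of all [u] with [<u, f0> < <u, g0>]; it is
    nonempty because reflexivity gives [f0 <> g0], and utilities separate acts.
    This excludes too much only if some related pair [(f, g)] satisfies
    [<u, f> < <u, g>] whenever [<u, f0> < <u, g0>]. Then the two differences
    are positively proportional as functionals of [u]
    ([proportional_functionals]), hence [f - g] and [f0 - g0] have the same
    direction, a contradiction. Only two functionals are compared at a time,
    so that elementary linear algebra takes the place of a separation theorem.

    That bounded continuous functions separate acts reduces, by utilities
    supported on one state, to their separating Borel probability measures on a
    metric space ([expect_inj]), where indicators of open sets are pointwise
    limits of continuous functions. *)

(** * Binary relations satisfying independence, against linear functionals *)

Section duality.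
Context {R : realType}.

Definition linear_on {E : lmodType R} (U : set E) (phi : E -> R) :=
  forall (a : R) u v, U u -> U v -> phi (a *: u + v) = a * phi u + phi v.

Definition affine_on {V : lmodType R} (S : set V) (psi : V -> R) :=
  forall f g, S f -> S g -> forall alpha : R, 0 <= alpha <= 1 ->
    psi (alpha *: f + (1 - alpha) *: g) = alpha * psi f + (1 - alpha) * psi g.

Definition convex_on {V : lmodType R} (S : set V) :=
  forall f g, S f -> S g -> forall alpha : R, 0 <= alpha <= 1 ->
    S (alpha *: f + (1 - alpha) *: g).

Lemma linear_on0 {E : lmodType R} (U : {pred E}) (phi : E -> R) :
  submod_closed U -> linear_on [set` U] phi -> phi 0 = 0.
Proof.
move=> [U0 _] phiL.
by have := phiL (-1) 0 0 U0 U0; rewrite scaler0 addr0; lra.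
Qed.

(** This replaces a separation theorem. Positivity of [psi] wherever [phi] is
    positive forces [psi] to vanish on the kernel of [phi]: adding to a point
    where [phi] is positive a multiple of a kernel vector leaves [phi]
    unchanged but could bring [psi] down to 0. Functionals with nested kernels
    are proportional. *)
Lemma proportional_functionals {E : lmodType R} (U : {pred E}) (phi psi : E -> R) :
  submod_closed U -> linear_on [set` U] phi -> linear_on [set` U] psi ->
  (exists2 u, u \in U & 0 < phi u) ->
  (forall u, u \in U -> 0 < phi u -> 0 < psi u) ->
  exists2 lambda : R, 0 < lambda & forall u, u \in U -> psi u = lambda * phi u.
Proof.
move=> Usub phiL psiL [u Uu phiu_gt0] phi_psi.
have phi0 := linear_on0 Usub phiL; have psi0 := linear_on0 Usub psiL.
have [U0 UL] := Usub.
have psi_ker w : w \in U -> phi w = 0 -> psi w = 0.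
  move=> Uw phiw; apply/eqP; apply: contraT => psiw.
  (* The multiple of w that makes psi vanish while phi keeps its value at u *)
  have := phi_psi (- (psi u / psi w) *: w + u) (UL _ _ _ Uw Uu).
  rewrite phiL// psiL// phiw mulr0 add0r => /(_ phiu_gt0).
  by rewrite mulNr divfK// addNr ltxx.
exists (psi u / phi u); first by rewrite divr_gt0// phi_psi.
move=> v Uv.
have Uw : - (phi v / phi u) *: u + v \in U by exact: UL.
have := psi_ker _ Uw; rewrite phiL// psiL// mulNr divfK ?gt_eqF// addNr.
move=> /(_ erefl) /eqP; rewrite addrC mulNr subr_eq0 => /eqP ->.
by rewrite mulrAC [RHS]mulrAC (mulrC (phi v)).
Qed.

(** Under independence, whether [(f, g)] is in the relation depends only on the
    direction of [f - g]. The equation between mixtures says that [f - g] is a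
    positive multiple of [f0 - g0], without leaving [S]: mixing [(f, g)] with
    [f0] gives the same pair as mixing [(f0, g0)] with [f]. *)
Lemma independence_cross {V : lmodType R} (S : set V) (Rel : set (V * V))
    (f g f0 g0 : V) (alpha : R) :
  independence_axiom S Rel -> S f -> S g -> S f0 -> S g0 -> 0 < alpha < 1 ->
  alpha *: g + (1 - alpha) *: f0 = alpha *: f + (1 - alpha) *: g0 ->
  Rel (f, g) -> Rel (f0, g0).
Proof.
move=> ind Sf Sg Sf0 Sg0 a01 cross.
have b01 : 0 < 1 - alpha < 1 by lra.
move=> /(ind _ _ _ Sf Sg Sf0 _ a01); rewrite cross => Rel_mix.
apply/(ind _ _ _ Sf0 Sg0 Sf _ b01); rewrite subKr.
by rewrite addrC [X in (_, X)]addrC.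
Qed.

(** The hard direction attaches to each pair [(f0, g0)] outside the relation
    the set of all [u] that rank [f0] strictly below [g0]. This set refutes
    [(f0, g0)] by construction. If it also refuted a pair [(f, g)], then
    [g - f] would be positive wherever [g0 - f0] is, hence a positive multiple
    of it as a functional; as [U] separates the points of [S], [f - g] and
    [f0 - g0] would have the same direction, and by independence [(f, g)] would
    not be in the relation either. *)
Theorem independence_representation {V E : lmodType R} (S : set V)
    (U : {pred E}) (T : V -> E -> R) (Rel : set (V * V)) :
  convex_on S -> submod_closed U ->
  (forall f, S f -> linear_on [set` U] (T f)) ->
  (forall u, u \in U -> affine_on S (T ^~ u)) ->
  (forall f g, S f -> S g -> (forall u, u \in U -> T f u = T g u) -> f = g) ->
  reflexive_on S Rel /\ independence_axiom S Rel
  <->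
  exists KK : set (set E),
    [/\ KK !=set0,
        forall K, KK K -> K `<=` [set` U] /\ K !=set0 &
        forall f g, S f -> S g ->
          (Rel (f, g) <-> forall K, KK K -> exists2 u, K u & T g u <= T f u)].
Proof.
move=> Scvx Usub Tlin Taff Tsep; split; last first.
  move=> [KK [_ KKU RelE]]; split.
    by move=> f Sf; apply/RelE => // K /KKU[_ [u Ku]]; exists u.
  move=> f g h Sf Sg Sh alpha /andP[a0 a1].
  have a01 : 0 <= alpha <= 1 by rewrite !ltW.
  rewrite !RelE//; [|exact: Scvx..].
  by split=> H K KKK; have [KU _] := KKU K KKK; have [u Ku Hu] := H K KKK;
    exists u => //; move: Hu; rewrite !(Taff _ (KU _ Ku)) // lerD2r ler_pM2l.
move=> [Rrefl ind].
have U0 : 0 \in U by case: Usub.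
have linD f g : S f -> S g -> linear_on [set` U] (fun u => T g u - T f u).
  by move=> Sf Sg a u v Uu Uv; rewrite !Tlin//; ring.
have T0 h : S h -> T h 0 = 0.
  by move=> Sh; exact: linear_on0 Usub (Tlin _ Sh).
have strict f g : S f -> S g -> ~ Rel (f, g) ->
    exists2 u, u \in U & 0 < T g u - T f u.
  move=> Sf Sg nfg; apply: contrapT => nu; apply: nfg.
  suff -> : f = g by exact: Rrefl.
  have le_gf u : u \in U -> T g u <= T f u.
    by move=> Uu; rewrite -subr_le0 leNgt; apply/negP => fg; apply: nu; exists u.
  apply: Tsep => // u Uu; apply/eqP; rewrite eq_le le_gf// andbT.
  (* Testing -u as well as u turns the inequality into an equality. *)
  have UNu : -1 *: u + 0 \in U by case: Usub => _; apply.
  have := le_gf _ UNu; rewrite !Tlin// !T0//; lra.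
(* [set 0] imposes no condition; it keeps the family nonempty when all pairs
   of S are related. *)
exists [set K | K = [set 0] \/ exists f g,
  [/\ S f, S g, ~ Rel (f, g) & K = [set u | u \in U /\ T f u < T g u]]].
split; first by exists [set 0]; left.
  move=> K [->|[f [g [Sf Sg nfg ->]]]].
    by split; [move=> _ ->|exists 0].
  split; first by move=> u [].
  by have [u Uu] := strict f g Sf Sg nfg; rewrite subr_gt0; exists u.
move=> f g Sf Sg; split=> [fg K|RelK].
  case=> [->|[f0 [g0 [Sf0 Sg0 nfg0 ->]]]].
    by exists 0 => //; rewrite !T0.
  apply: contrapT => noK; apply: (nfg0).
  have [||lambda l0 gfE] := proportional_functionals Usub
    (linD _ _ Sf0 Sg0) (linD _ _ Sf Sg).
  - exact: strict nfg0.
  - move=> u Uu; rewrite !subr_gt0 => f0g0; rewrite ltNge; apply/negP => gf.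
    by apply: noK; exists u.
  (* g - f = lambda (g0 - f0), normalized into an equation between mixtures. *)
  have a01 : 0 < (1 + lambda)^-1 < 1.
    by rewrite invr_gt0 invf_lt1//; lra.
  have a01' : 0 <= (1 + lambda)^-1 <= 1 by lra.
  apply: (independence_cross (alpha := (1 + lambda)^-1) ind Sf Sg) => //.
  apply: Tsep; [exact: Scvx..|move=> u Uu].
  rewrite !Taff//; have -> : T g u = T f u + lambda * (T g0 u - T f0 u).
    by rewrite -gfE// addrC subrK.
  by field; lra.
apply: contrapT => nfg.
have [|u [Uu fltg]] := RelK [set u | u \in U /\ T f u < T g u].
  by right; exists f, g.
by rewrite leNgt fltg.
Qed.

End duality.

(** * Elements of Delta as probability measures *)

Lemma integral_mscale d (T : measurableType d) (R : realType)
    (m : {measure set T -> \bar R}) (k : {nonneg R}) (D : set T) (f : T -> \bar R) :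
  measurable D -> m.-integrable D f ->
  (\int[mscale k m]_(x in D) f x = k%:num%:E * \int[m]_(x in D) f x)%E.
Proof.
move=> mD intf; have mf := measurable_int m intf.
rewrite [LHS]integralE [X in _ = (_ * X)%E]integralE.
rewrite !ge0_integral_mscale//; [|exact: measurable_funeneg|
  exact: measurable_funepos]; rewrite ?lee_fin//.
rewrite [RHS]muleBr//; apply: fin_num_adde_defr.
exact: integrable_pos_fin_num.
Qed.

(** Countable additivity applied to the constant sequence [set0] makes the
    partial sums converge; their constant increment [r set0] is thus 0. *)
Lemma ca_set0 {R : realType} {Z : topologicalType} (r : ca R Z) : r set0 = 0.
Proof.
have /asboolP[rs _] := valP r.
have b0 : borel (set0 : set Z) by have [] := @smallest_sigma_algebra Z setT open.
have triv0 : trivIset [set: nat] (fun=> set0 : set Z).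
  by apply/trivIsetP => i j _ _ _; rewrite setI0.
have := rs _ (fun=> b0) triv0.
rewrite bigcup0// => rcvg.
have rcvgS : (fun n => \sum_(i < n.+1) r set0) @ \oo --> r set0.
  exact: (cvg_comp _ _ (cvg_addnl 1) rcvg).
have c0 : cst (r set0) @ \oo --> (0 : R^o).
  have <- : (fun n => \sum_(i < n.+1) r set0) - (fun n => \sum_(i < n) r set0)
      = cst (r set0).
    by apply/funext => n; rewrite !fctE/= big_ord_recr/= addrC addKr.
  by have := cvgB rcvgS rcvg; rewrite subrr; apply.
by rewrite -(cvg_lim _ c0) ?lim_cst.
Qed.

(** Off the Borel sets, elements of [ca R Z] are 0 by convention. *)
Lemma Delta_ge0 {R : realType} {Z : topologicalType} (r : ca R Z) (A : set Z) :
  Delta R Z r -> 0 <= r A.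
Proof.
move=> rD.
have [bA|nbA] := pselect (borel A); first exact: rD.1.
by have /asboolP[_ ->] := valP r.
Qed.

Section delta_measure.
Context {R : realType} {Z : topologicalType} (z0 : Z) (r : ca R Z).
Hypothesis rD : Delta R Z r.

(** The membership proof is an argument so that the probability structure below
    can be inferred from the term. *)
Definition delta_measure of Delta R Z r : set (borel_at z0) -> \bar R :=
  fun A => (r A)%:E.
Local Notation mu := (delta_measure rD).

Let mu0 : mu set0 = 0%E. Proof. by rewrite /mu ca_set0. Qed.

Let mu_ge0 A : (0 <= mu A)%E. Proof. by rewrite lee_fin Delta_ge0. Qed.

Let mu_sigma_additive : semi_sigma_additive mu.
Proof.
move=> F mF tF _; have /asboolP[/(_ F mF tF) rcvg _] := valP r.
rewrite (_ : (fun n => _) = EFin \o (fun n => \sum_(i < n) r (F i))).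
  by apply: cvg_EFin; [exact: nearW|exact: rcvg].
by apply/funext => n; rewrite big_mkord /= sumEFin.
Qed.

HB.instance Definition _ :=
  isMeasure.Build _ _ _ mu mu0 mu_ge0 mu_sigma_additive.

HB.instance Definition _ :=
  Measure_isProbability.Build _ _ _ mu (congr1 EFin rD.2).

End delta_measure.
Arguments delta_measure {R Z} z0 {r}.

(** * Expectations of bounded continuous functions *)

Section expectation.
Context {R : realType} {Z : topologicalType}.

Lemma Delta_nonempty (r : ca R Z) : Delta R Z r -> [set: Z] !=set0.
Proof.
move=> [_ r1]; apply/set0P/eqP => Z0.
by move: r1; rewrite Z0 ca_set0 => /esym/eqP; rewrite oner_eq0.
Qed.

(** The base point is chosen from an arbitrary nonemptiness proof [Z0], so that
    the expectations of several measures become integrals on one and the same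
    measurable type. *)
Lemma expectE (Z0 : [set: Z] !=set0) (r : ca R Z) (rD : Delta R Z r) (v : Z -> R) :
  expect r v = (\int[delta_measure (projT1 (cid Z0)) rD]_x v x)%R.
Proof.
rewrite /expect; case: pselect => // Z0'.
by rewrite (Prop_irrelevance Z0' Z0).
Qed.

Lemma Cb_measurable (z0 : Z) (v : Z -> R) : Cb R Z v ->
  measurable_fun [set: borel_at z0] v.
Proof.
move=> [/continuousP cv _].
apply: (measurability _ (RGenOpens.measurableE R)) => _ [_ [a [b ->] <-]].
by rewrite setTI; apply: sub_sigma_algebra; exact/cv/interval_open.
Qed.

Lemma Cb_integrable (z0 : Z) (P : probability (borel_at z0) R) (v : Z -> R) :
  Cb R Z v -> P.-integrable [set: borel_at z0] (EFin \o v).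
Proof.
move=> Cv; apply: measurable_bounded_integrable => //.
- by rewrite -ge0_fin_numE//; exact: fin_num_measure.
- exact: Cb_measurable.
- exact: Cv.2.
Qed.

Lemma expect_linear (r : ca R Z) (a : R) (u v : Z -> R) :
  Delta R Z r -> Cb R Z u -> Cb R Z v ->
  expect r (fun z => a * u z + v z) = a * expect r u + expect r v.
Proof.
move=> rD Cu Cv; rewrite !(expectE (Delta_nonempty rD) rD).
have iu := Cb_integrable (delta_measure (projT1 (cid (Delta_nonempty rD))) rD) Cu.
have iv := Cb_integrable (delta_measure (projT1 (cid (Delta_nonempty rD))) rD) Cv.
rewrite RintegralD//; last exact: (integrableZl measurableT a iu).
by rewrite RintegralZl.
Qed.

Lemma Delta_convex (r s : ca R Z) (alpha : R) : Delta R Z r -> Delta R Z s ->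
  0 <= alpha <= 1 -> Delta R Z (alpha *: r + (1 - alpha) *: s).
Proof.
move=> rD sD a01; split=> [A bA|]; rewrite /= !fctE.
  by rewrite addr_ge0// mulr_ge0//; [lra|exact: rD.1|lra|exact: sD.1].
by rewrite rD.2 sD.2 /GRing.scale/= !mulr1 addrC subrK.
Qed.

Lemma expect_affine (r s : ca R Z) (alpha : R) (v : Z -> R) :
  Delta R Z r -> Delta R Z s -> 0 <= alpha <= 1 -> Cb R Z v ->
  expect (alpha *: r + (1 - alpha) *: s) v =
  alpha * expect r v + (1 - alpha) * expect s v.
Proof.
move=> rD sD a01 Cv.
have a0 : 0 <= alpha by lra.
have b0 : 0 <= 1 - alpha by lra.
have Z0 := Delta_nonempty rD; rewrite !(expectE Z0 (Delta_convex rD sD a01)).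
rewrite (expectE Z0 rD) (expectE Z0 sD).
set mr := delta_measure _ rD; set ms := delta_measure _ sD.
have ir := Cb_integrable mr Cv; have is_ := Cb_integrable ms Cv.
rewrite /Rintegral.
rewrite (eq_measure_integral (measure_add (mscale (NngNum a0) mr)
  (mscale (NngNum b0) ms))); last first.
  by move=> A mA _; rewrite [RHS]measure_addE.
have mv := measurable_int mr ir.
have iscale (k : {nonneg R}) (m : probability (borel_at (projT1 (cid Z0))) R) :
    (mscale k m).-integrable setT (EFin \o v).
  apply: measurable_bounded_integrable => //.
  - rewrite /= /mscale lte_mul_pinfty//.
    by rewrite -ge0_fin_numE//; exact: fin_num_measure.
  - exact: Cb_measurable.
  - exact: Cv.2.
rewrite integral_measure_add//; [|exact: iscale..].
rewrite !integral_mscale//.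
by rewrite fineD ?fineM ?fin_numM ?integrable_fin_num.
Qed.

End expectation.

(** * Bounded continuous functions separate probability measures *)

Section separation.
Context {R : realType}.

Lemma le_bounded_fun (T : Type) (M : R) (v : T -> R) :
  (forall x, `|v x| <= M) -> bounded_fun v.
Proof.
move=> vM; exists M; split; first exact: num_real.
by move=> y My x _; apply: le_trans (vM x) (ltW My).
Qed.

(** With [d] the distance to the complement of [U] truncated at 1, the functions
    [1 - (1 - d) ^+ n] vanish off [U] and tend to 1 where [d] is positive, that
    is, on [U]. *)
Lemma open_indic_approx (Z : metricType R) (U : set Z) : open U ->
  exists v : nat -> Z -> R, [/\ forall n, Cb R Z (v n),
    forall n z, 0 <= v n z <= 1 & forall z, v ^~ z @ \oo --> (\1_U z : R)].
Proof.
(* The distance to an empty complement is infinite, and [fine] would send it to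
   0; hence the separate case. *)
move=> oU; have [UC0|/set0P[a Ua]] := eqVneq (~` U) set0.
  exists (fun _ _ => 1); split.
  - move=> n; split; first by move=> z; exact: cvg_cst.
    by apply: (@le_bounded_fun _ 1) => z; rewrite normr1.
  - by move=> n z; rewrite ler01 lexx.
  - by move=> z; rewrite -[U]setCK UC0 setC0 indicT; exact: cvg_cst.
have dfin z : edist_inf (~` U) z \is a fin_num.
  rewrite ge0_fin_numE ?edist_inf_ge0//.
  apply: (@le_lt_trans _ _ (edist (z, a))).
    by apply: ereal_inf_lbound; exists a.
  rewrite -ge0_fin_numE ?edist_ge0//; apply/edist_finP.
  exists (mdist z a + 1); first by rewrite ltr_wpDl ?mdist_ge0.
  by rewrite ballEmdist/= ltrDl.
pose d := (fun z => fine (edist_inf (~` U) z)) \min (fun=> 1 : R).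
have d01 z : 0 <= d z <= 1.
  by rewrite /d/= le_min ge_min ler01 lexx orbT !andbT fine_ge0// edist_inf_ge0.
have dc : continuous d.
  move=> z; apply: continuous_min; last exact: cvg_cst.
  by apply: fine_cvg; rewrite fineK//; exact: edist_inf_continuous.
have dU z : U z -> 0 < d z.
  move=> Uz; rewrite /d/= lt_min ltr01 andbT.
  have [/= e e0 eU] : nbhs_ball z U by rewrite nbhs_ballE; exact: open_nbhs_nbhs.
  apply: (lt_le_trans e0); rewrite leNgt; apply/negP.
  rewrite -lte_fin fineK// => /ereal_inf_lt[_ [b nUb <-] zb].
  by apply: nUb; apply: eU; exact: (edist_lt_ball zb).
have dUC z : ~ U z -> d z = 0.
  by move=> nUz; rewrite /d/= edist_inf0// min_l.
have pow01 n z : 0 <= (1 - d z) ^+ n <= 1.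
  by have := d01 z => d01z; rewrite exprn_ge0 ?exprn_ile1//; lra.
have v01 n z : 0 <= 1 - (1 - d z) ^+ n <= 1 by have := pow01 n z; lra.
exists (fun n z => 1 - (1 - d z) ^+ n); split => //.
- move=> n; split.
    move=> z; apply: cvgB; first exact: cvg_cst.
    apply: (@continuous_comp _ _ _ (fun z => 1 - d z) (fun x : R => x ^+ n) z);
      last exact: exprn_continuous.
    by apply: cvgB; [exact: cvg_cst|exact: dc].
  apply: (@le_bounded_fun _ 1) => z; rewrite ger0_norm.
    by case/andP: (v01 n z).
  by case/andP: (v01 n z).
- move=> z; rewrite indicE; have [Uz|nUz] := pselect (U z).
    rewrite mem_set//= -[X in _ --> X]subr0.
    apply: cvgB; first exact: cvg_cst.
    apply: cvg_expr; rewrite ger0_norm; have := d01 z; have := dU z Uz; lra.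
  rewrite memNset//= dUC// subr0.
  by under eq_fun do rewrite expr1n subrr; exact: cvg_cst.
Qed.

Lemma probability_open_cvg (Z : metricType R) (z0 : Z) (U : set Z)
    (v : nat -> Z -> R) (P : probability (borel_at z0) R) :
  open U -> (forall n, Cb R Z (v n)) -> (forall n z, 0 <= v n z <= 1) ->
  (forall z, v ^~ z @ \oo --> (\1_U z : R)) ->
  ((\int[P]_x v n x)%:E @[n --> \oo] --> P U)%R.
Proof.
move=> oU Cv v01 vU.
have mU : measurable (U : set (borel_at z0)) by exact: sub_sigma_algebra.
have := @dominated_convergence _ (borel_at z0) R P setT measurableT
  (fun n => EFin \o v n) (EFin \o \1_U) (cst 1%E).
case.
- by move=> n; apply/measurable_EFinP; exact: Cb_measurable.
- by apply/measurable_EFinP; exact: measurable_indic.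
- apply: aeW => z _; apply: cvg_EFin; first exact: nearW.
  exact: vU.
- exact: finite_measure_integrable_cst.
- apply: aeW => z n _; rewrite /= lee_fin ger0_norm; by case/andP: (v01 n z).
- move=> _ _; rewrite integral_indic// setIT; apply: cvg_trans.
  rewrite (_ : (fun n => _) = [sequence (\int[P]_x (EFin \o v n) x)%E]_n)//.
  apply/funext => n; rewrite /Rintegral fineK//.
  by apply: integrable_fin_num => //; exact: Cb_integrable.
Qed.

(** Equal expectations give equal masses to open sets by dominated convergence;
    open sets are stable under intersection and generate the Borel sets, and
    off the Borel sets both sides are 0. *)
Lemma expect_inj (Z : metricType R) (r s : ca R Z) :
  Delta R Z r -> Delta R Z s ->
  (forall v, Cb R Z v -> expect r v = expect s v) -> r = s.
Proof.
move=> rD sD rs; have Z0 := Delta_nonempty rD.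
pose mr := delta_measure (projT1 (cid Z0)) rD.
pose ms := delta_measure (projT1 (cid Z0)) sD.
have mrs A : borel A -> mr A = ms A.
  apply: (@measure_unique _ R (borel_at (projT1 (cid Z0))) (@open Z)
    (fun=> setT) _ _ _ _ mr ms) => //.
  - exact: openI.
  - by move=> _; exact: openT.
  - by rewrite bigcup_const//; exists 0.
  - move=> U oU; have [v [Cv v01 vU]] := open_indic_approx oU.
    have rU := probability_open_cvg (P := mr) oU Cv v01 vU.
    have sU := probability_open_cvg (P := ms) oU Cv v01 vU.
    have rsv : (fun n => (\int[mr]_x v n x)%:E) = (fun n => (\int[ms]_x v n x)%:E).
      apply/funext => n; congr EFin.
      by rewrite -(expectE Z0 rD) -(expectE Z0 sD); exact: rs.
    by move: rU; rewrite rsv => rU; exact: cvg_unique rU sU.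
  - by move=> _; rewrite -ge0_fin_numE//; exact: fin_num_measure.
apply/val_inj/funext => A; have [bA|nbA] := pselect (borel A).
  by have [] := mrs A bA.
have /asboolP[_ ->//] := valP r.
by have /asboolP[_ ->] := valP s.
Qed.

End separation.

(** * Acts and state-dependent utilities *)

Section acts.
Context {R : realType} {Omega : finType} {Z : metricType R}.
Local Notation ZO := (Z * discrete_topology Omega)%type.

Definition act_value (f : Omega -> ca R Z) (u : ZO -> R^o) : R :=
  \sum_(w : Omega) expect (f w) (fun z => u (z, w)).

Lemma Cb_section (u : ZO -> R) (w : Omega) : Cb R ZO u -> Cb R Z (fun z => u (z, w)).
Proof.
move=> [cu bu]; split.
  move=> z; apply: (@continuous_comp _ _ _ (fun z => (z, w) : ZO) u); last exact: cu.
  by apply: (@cvg_pair Z Z (discrete_topology Omega) _ (nbhs z)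
    (nbhs (w : discrete_topology Omega))); [exact: cvg_id|exact: cvg_cst].
by case: bu => M [Mr uM]; exists M; split => // x Mx z _; exact: uM.
Qed.

(** Continuity holds since the second factor is discrete: near any point, the
    function is either [v] of the first coordinate or 0. *)
Lemma Cb_extend (v : Z -> R) (w0 : Omega) : Cb R Z v ->
  Cb R ZO (fun p => if p.2 == w0 then v p.1 else 0).
Proof.
move=> [cv bv]; split; last first.
  case: bv => M [Mr vM]; exists (Num.max M 0); split; first exact: num_real.
  move=> x; rewrite gt_max => /andP[Mx x0] [z w] _ /=.
  by case: ifP => _; [exact: vM|rewrite normr0 ltW].
move=> [z w] /=.
have near_w : \forall p \near ((z, w) : ZO), p.2 = w.
  by exists (setT, [set w]) => /=; [split; [exact: filterT|]|move=> [? ?] []].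
have [w_eq|w_neq] := eqVneq w w0.
- have v1 : (fun p : ZO => v p.1) @ ((z, w) : ZO) --> v z.
    by apply: (cvg_comp (fun p : ZO => p.1) v _ (cv z)); exact: cvg_fst.
  subst w0; rewrite /continuous_at/= eqxx; apply: cvg_trans v1.
  by apply: near_eq_cvg; apply: filterS near_w => p ->; rewrite eqxx.
- rewrite /continuous_at/= (negbTE w_neq).
  have c0 : (fun=> 0 : R) @ ((z, w) : ZO) --> (0 : R) by exact: cvg_cst.
  apply: cvg_trans c0.
  by apply: near_eq_cvg; apply: filterS near_w => p ->; rewrite (negbTE w_neq).
Qed.

Lemma Cb_submod : submod_closed (mem (Cb R ZO : set (ZO -> R^o))).
Proof.
split; first rewrite inE; last move=> a u v; rewrite ?inE.
  split; first by move=> z; exact: cvg_cst.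
  by apply: (@le_bounded_fun _ _ 0) => z; rewrite normr0.
move=> [cu bu] [cv bv]; split.
  by move=> z; apply: cvgD; [apply: cvgZl_tmp; exact: cu|exact: cv].
case: bu => M [Mr uM]; case: bv => N [Nr vN].
apply: (@le_bounded_fun _ _ (`|a| * (M + 1) + (N + 1))) => z.
rewrite (le_trans (ler_normD _ _))// lerD//; last by apply: vN; rewrite ?ltrDl.
by rewrite normrM ler_wpM2l//; apply: uM; rewrite ?ltrDl.
Qed.

Lemma acts_convex : convex_on (acts R Omega Z).
Proof. by move=> f g Sf Sg a a01 w; exact: Delta_convex. Qed.

Lemma act_value_linear f : acts R Omega Z f ->
  linear_on [set` mem (Cb R ZO : set (ZO -> R^o))] (act_value f).
Proof.
move=> fD a u v /=; rewrite !inE => Cu Cv.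
rewrite /act_value mulr_sumr -big_split; apply: eq_bigr => w _.
exact: (expect_linear a (fD w) (Cb_section w Cu) (Cb_section w Cv)).
Qed.

Lemma act_value_affine (u : ZO -> R^o) : Cb R ZO u ->
  affine_on (acts R Omega Z) (act_value ^~ u).
Proof.
move=> Cu f g Sf Sg a a01.
rewrite /act_value !mulr_sumr -big_split; apply: eq_bigr => w _.
exact: (expect_affine (Sf w) (Sg w) a01 (Cb_section w Cu)).
Qed.

(** Utilities supported on a single state isolate the components of an act. *)
Lemma act_value_inj f g : acts R Omega Z f -> acts R Omega Z g ->
  (forall u, Cb R ZO u -> act_value f u = act_value g u) -> f = g.
Proof.
move=> Sf Sg fg; apply/funext => w0; apply: expect_inj => // v Cv.
have := fg _ (Cb_extend w0 Cv); rewrite /act_value /=.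
have value_extend h : acts R Omega Z h ->
    \sum_w expect (h w) (fun z => if w == w0 then v z else 0) =
    expect (h w0) v.
  move=> Sh; rewrite (bigD1 w0)//= eqxx big1 ?addr0// => w /negbTE ->.
  have Z0 := Delta_nonempty (Sh w).
  by rewrite (expectE Z0 (Sh w)) /Rintegral integral0.
by rewrite !value_extend.
Qed.

End acts.

Theorem corollary4p4 (R : realType) (Omega : finType) (Omega0 : (0 < #|Omega|)%N)
    (Z : metricType R) (Zsep : separable Z)
    (Rel : set ((Omega -> ca R Z) * (Omega -> ca R Z)))
    (RelF : binary_relation (acts R Omega Z) Rel) :
  reflexive_on (acts R Omega Z) Rel /\ independence_axiom (acts R Omega Z) Rel
  <->
  exists KK : set (set (Z * discrete_topology Omega -> R)),
    [/\ KK !=set0,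
        forall K, KK K ->
          K `<=` Cb R (Z * discrete_topology Omega)%type /\ K !=set0 &
        forall f g, acts R Omega Z f -> acts R Omega Z g ->
          (Rel (f, g) <->
           forall K, KK K -> exists2 u, K u &
             \sum_(w : Omega) expect (f w) (fun z => u (z, w)) >=
             \sum_(w : Omega) expect (g w) (fun z => u (z, w)))].
Proof.
have := @independence_representation R _ _ (acts R Omega Z)
  (mem (Cb R (Z * discrete_topology Omega)%type :
    set (Z * discrete_topology Omega -> R^o)))
  act_value Rel acts_convex Cb_submod (@act_value_linear R Omega Z).
have -> : [set` mem (Cb R (Z * discrete_topology Omega)%type :
    set (Z * discrete_topology Omega -> R^o))] =
    Cb R (Z * discrete_topology Omega)%type.
  exact: set_mem_set.
apply.
- by move=> u; rewrite inE; exact: act_value_affine.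
- move=> f g Sf Sg fg; apply: act_value_inj => // u Cu.
  by apply: fg; rewrite inE.
Qed.
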